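(* Let $U$ be a nonempty bounded open subset of $\mathbb{R}^d$ and let $(X_n)_{n\ge1}$ be a sequence of independent random points, each uniformly distributed in $U$ (i.e. with law $\mathcal{L}^d(\cdot\cap U)/\mathcal{L}^d(U)$). Then, with probability one, $(X_n)_{n\ge1}$ is uniformly eutaxic in $U$.
   Context: Fix a norm $|\cdot|$ on $\mathbb{R}^d$; $\mathcal{L}^d$ is Lebesgue measure. $\mathrm{P}_d$ is the set of real sequences $(r_n)_{n\ge1}$ with $r_{n+1}\le r_n$, $r_n\to0$ and $\sum_nr_n^d=\infty$. A sequence $(x_n)$ in $\mathbb{R}^d$ is uniformly eutaxic in $U$ if for every $(r_n)\in\mathrm{P}_d$, $\mathcal{L}^d$-almost every $x\in U$ satisfies $|x-x_n|<r_n$ for infinitely many $n$. *)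

(* Defs.v *)
From HB Require Import structures.
From mathcomp Require Import all_boot all_order all_algebra.
From mathcomp Require Import all_classical all_reals all_analysis.

Set Implicit Arguments.
Unset Strict Implicit.
Unset Printing Implicit Defensive.
Import Order.TTheory GRing.Theory Num.Theory.
Import numFieldNormedType.Exports.
Local Open Scope classical_set_scope.
Local Open Scope ring_scope.

Definition is_norm (R : realType) (d : nat) (N : 'rV[R]_d -> R) : Prop :=
  [/\ forall x, N x = 0 -> x = 0,
      forall x y, N (x + y) <= N x + N y
    & forall (a : R) x, N (a *: x) = `|a| * N x].

Definition box (R : realType) (d : nat) (a b : 'rV[R]_d) : set 'rV[R]_d :=
  [set x | forall i : 'I_d, a ord0 i <= x ord0 i <= b ord0 i].

Definition box_vol (R : realType) (d : nat) (a b : 'rV[R]_d) : R :=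
  \prod_(i < d) Num.max 0 (b ord0 i - a ord0 i).

(* d-dimensional Lebesgue (outer) measure L^d: infimum of the total volume of
   countable covers by boxes.  On Borel sets it is Lebesgue measure; its null
   sets are exactly the L^d-null sets. *)
Definition lebesgue_outer (R : realType) (d : nat) (A : set 'rV[R]_d) : \bar R :=
  ereal_inf [set s : \bar R | exists a b : nat -> 'rV[R]_d,
     A `<=` \bigcup_k box (a k) (b k) /\
     s = (\sum_(0 <= k <oo) (box_vol (a k) (b k))%:E)%E].

Definition borel_Rd (R : realType) (d : nat) : set (set 'rV[R]_d) :=
  <<s [set O : set 'rV[R]_d | open O] >>.

Definition radii_seq (R : realType) (d : nat) (r : nat -> R) : Prop :=
  [/\ forall n, r n.+1 <= r n,
      r @ \oo --> (0 : R)
    & (\sum_(0 <= n <oo) ((r n) ^+ d)%:E = +oo)%E].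

Definition uniformly_eutaxic (R : realType) (d : nat) (N : 'rV[R]_d -> R)
    (U : set 'rV[R]_d) (x : nat -> 'rV[R]_d) : Prop :=
  forall r : nat -> R, radii_seq d r ->
    lebesgue_outer [set y | U y /\
       finite_set [set n | N (y - x n) < r n]] = 0%E.

Definition independent_rvs (R : realType) (dT : measure_display)
    (T : measurableType dT) (P : probability T R) (d : nat)
    (X : nat -> T -> 'rV[R]_d) : Prop :=
  forall (J : seq nat) (B : nat -> set 'rV[R]_d), uniq J ->
    (forall i, i \in J -> borel_Rd (B i)) ->
    P (\bigcap_(i in [set i | i \in J]) (X i @^-1` B i)) =
    (\prod_(i <- J) P (X i @^-1` B i))%E.

(* Main.v *)
Require Import Defs.
From HB Require Import structures.
From mathcomp Require Import all_boot all_order all_algebra.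
From mathcomp Require Import all_classical all_reals all_analysis.
From mathcomp Require Import ring lra zify.
Import Order.TTheory GRing.Theory Num.Theory.
Import numFieldNormedType.Exports.
Local Open Scope classical_set_scope.
Local Open Scope ring_scope.

(* Let [mu] be the common law of the points. Its explicit form makes
   [lebesgue_outer] additive on the Borel subsets of [U], so translation and
   scaling alone give all cells of side [s / 8 ^ l] inside [U] the same mass
   [p0 / D ^ l], with [D = 8 ^ d].
   By a union bound and Borel-Cantelli, almost surely, inside every cell
   contained in [U] and for all large [j], the points with index in
   [M D ^ j, 2 M D ^ j) hit at least half of the subcells of level [j].
   For such a sequence of points fix radii and put around one point of each hit
   subcell a cell of level [k j >= j] lying in the ball of that point. The mass
   a level adds to the union of the previous ones is at least a constant times
   [D ^ (j - k j)] as long as the union fills less than an eighth of the big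
   cell, and Cauchy condensation makes the sum of these terms diverge. Hence the
   set of points of [U] avoided by all balls of index at least [m] fills at most
   7/8 of every cell, and a dyadic density argument shows that it is null. *)

(** * Finite unions under a probability *)

Section fine_probability.
Context {R : realType} {dW : measure_display} {W : measurableType dW}.
Variable mu : probability W R.
Local Notation m A := (fine (mu A)).

Lemma fine_probability_ge0 (A : set W) : 0 <= m A.
Proof. by rewrite fine_ge0. Qed.

Lemma fine_probabilityK (A : set W) : measurable A -> (m A)%:E = mu A.
Proof. by move=> mA; rewrite fineK// fin_num_measure. Qed.

Lemma le_fine_probability (A B : set W) :
  measurable A -> measurable B -> A `<=` B -> m A <= m B.
Proof.
move=> mA mB AB; rewrite fine_le ?fin_num_measure//.
by rewrite le_measure ?inE.
Qed.

Lemma fine_probability_le1 (A : set W) : measurable A -> m A <= 1.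
Proof. by move=> mA; rewrite -lee_fin fine_probabilityK// probability_le1. Qed.

Lemma fine_probabilityU (A B : set W) : measurable A -> measurable B ->
  A `&` B = set0 -> m (A `|` B) = m A + m B.
Proof.
move=> mA mB AB; rewrite measureU//.
by rewrite fineD ?fin_num_measure.
Qed.

Lemma fine_probabilityU_le (A B : set W) : measurable A -> measurable B ->
  m (A `|` B) <= m A + m B.
Proof.
move=> mA mB; rewrite -fineD ?fin_num_measure// fine_le ?fin_num_measure//.
- exact: measurableU.
- by rewrite fin_numD !fin_num_measure.
- exact: measureU2.
Qed.

Lemma fine_probability_bigcup (I : finType) (A : {set I}) (F : I -> set W) :
  (forall i, i \in A -> measurable (F i)) ->
  (forall i j x, i \in A -> j \in A -> F i x -> F j x -> i = j) ->
  m (\bigcup_(i in [set` A]) F i) = \sum_(i in A) m (F i).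
Proof.
move=> mF dF; rewrite measure_fin_bigcup//; last first.
  by move=> i j /= iA jA [x [Fi Fj]]; exact: dF Fi Fj.
have -> : [set` A] = [set` enum A].
  by apply/seteqP; split=> i /=; rewrite mem_enum.
rewrite -fsbig_seq ?enum_uniq// big_enum/= -sum_fine// => i iA.
by rewrite fin_num_measure//; exact: mF.
Qed.

Lemma fine_probability_bigcup_le (I : finType) (A : {set I}) (F : I -> set W) :
  (forall i, i \in A -> measurable (F i)) ->
  m (\bigcup_(i in [set` A]) F i) <= \sum_(i in A) m (F i).
Proof.
move=> mF; rewrite -big_enum/=.
have -> : [set` A] = [set` enum A].
  by apply/seteqP; split=> i /=; rewrite mem_enum.
have {}mF i : i \in enum A -> measurable (F i) by rewrite mem_enum; exact: mF.
elim: (enum A) mF => [|i s IH] mF.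
  by rewrite big_nil bigcup_seq big_nil measure0.
rewrite big_cons bigcup_seq big_cons -bigcup_seq.
have ms : measurable (\bigcup_(i in [set` s]) F i).
  by apply: fin_bigcup_measurable => // j js; apply: mF; rewrite inE js orbT.
apply: (le_trans (fine_probabilityU_le _ _ _ ms)).
  by apply: mF; rewrite inE eqxx.
by rewrite lerD2l IH// => j js; apply: mF; rewrite inE js orbT.
Qed.

(** Every point leaves [Z] for good, so the limsup is empty; the tail unions shrink to it and their
    measures tend to 0. *)
Lemma fine_probability_small (Z : nat -> set W) (e : R) :
  (forall k, measurable (Z k)) ->
  (forall y, exists k0, forall k, (k0 <= k)%N -> ~ Z k y) ->
  0 < e -> exists k, fine (mu (Z k)) < e.
Proof.
move=> mZ outZ e0.
have mtail n : measurable (\bigcup_(j in [set j | (n <= j)%N]) Z j).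
  exact: bigcup_measurable.
have sup0 : lim_sup_set Z = set0.
  apply/seteqP; split=> // y limy; have [k0 out] := outZ y.
  by have [k /= k0k /(out _ k0k)] := limy k0 I.
have : (mu (\bigcup_(j in [set j | (n <= j)%N]) Z j))%E @[n --> \oo] --> 0%:E.
  have <- : mu (lim_sup_set Z) = 0%:E by rewrite sup0 measure0.
  apply: lim_sup_set_cvg => //.
  by rewrite (le_lt_trans (probability_le1 _ _)) ?ltry.
move=> /fine_cvgP[_ /cvgrPdist_lt/(_ e e0)[k _ /(_ k (leqnn k))/=]].
rewrite sub0r normrN ger0_norm ?fine_probability_ge0// => ke; exists k.
apply: le_lt_trans ke; apply: le_fine_probability => // y Zy.
by exists k => /=.
Qed.

End fine_probability.

(** * Nested partitions with equal masses *)

(** A geometric series of ratio at most 1/8. The quarter is the share of a big cell that earlier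
    levels may block. *)
Lemma sum_expr_le_quarter (R : realFieldType) (q : R) (j : nat) :
  0 <= q <= 8^-1 -> \sum_(i < j) q ^+ (j - i) <= 4^-1.
Proof.
move=> /andP[q0 q8]; elim: j => [|j IH]; first by rewrite big_ord0; lra.
rewrite big_ord_recr/= subSnn expr1.
under eq_bigr => i _ do rewrite subSn 1?ltnW// exprS.
rewrite -mulr_sumr; set s := \sum_(_ < _) _ in IH *.
have s0 : 0 <= s by apply: sumr_ge0 => i _; rewrite exprn_ge0.
by have : q * s <= 8^-1 * 4^-1; [exact: ler_pM | lra].
Qed.

Section cell_tree.
Context {R : realType} {dW : measure_display} {W : measurableType dW}.
Variable mu : probability W R.
Local Notation m A := (fine (mu A)).
Variables (T : nat -> finType) (Q : forall l, T l -> set W).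
Variables (U : set W) (p0 q : R).
Hypothesis Qdisj : forall l t u y, Q l t y -> Q l u y -> t = u.
Hypothesis Qnest : forall l k t u y, (l <= k)%N ->
  Q k t y -> Q l u y -> Q k t `<=` Q l u.
Hypothesis mQ : forall l t, measurable (Q l t).
Hypothesis Qcover : forall l y, U y -> exists t, Q l t y.
Hypothesis Qmass : forall l t, Q l t `<=` U -> m (Q l t) = p0 * q ^+ l.
Hypothesis p0_ge0 : 0 <= p0.
Hypothesis q_itv : 0 < q <= 8^-1.
Local Notation p l := (p0 * q ^+ l).

Let q_ge0 : 0 <= q. Proof. by case/andP: q_itv => /ltW. Qed.

Let p_ge0 l : 0 <= p l. Proof. by rewrite mulr_ge0 ?exprn_ge0. Qed.

(** Written as a relation, the cell around [y] needs no choice of index and is empty when no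
    level-[k] cell contains [y]. *)
Definition point_cell k (y : W) : set W :=
  [set z | exists2 s : T k, Q k s y & Q k s z].

Lemma point_cellE k (s : T k) y : Q k s y -> point_cell k y = Q k s.
Proof.
move=> Qy; apply/seteqP; split=> [z [s' Qs' Qz]|z Qz]; last by exists s.
by rewrite (Qdisj _ _ _ _ Qy Qs').
Qed.

Lemma measurable_point_cell k y : measurable (point_cell k y).
Proof.
have [[s Qs]|nQ] := pselect (exists s, Q k s y); first by rewrite (point_cellE _ s).
rewrite (_ : point_cell k y = set0)//; apply/seteqP; split=> // z [s Qs _].
by apply: nQ; exists s.
Qed.

Lemma point_cell_nest j k t y : (j <= k)%N -> Q j t y -> point_cell k y `<=` Q j t.
Proof.
by move=> jk Qy z [s Qs Qz]; exact: (Qnest _ _ _ _ _ jk Qs Qy).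
Qed.

Lemma point_cell_mass j k t y : (j <= k)%N -> Q j t `<=` U -> Q j t y ->
  m (point_cell k y) = p k.
Proof.
move=> jk tU Qy; have [s Qs] := Qcover k _ (tU _ Qy).
rewrite (point_cellE _ _ _ Qs) Qmass//.
by apply: subset_trans tU; exact: (Qnest _ _ _ _ _ jk Qs Qy).
Qed.

Lemma cells_mass l (A : {set T l}) : (forall t, t \in A -> Q l t `<=` U) ->
  m (\bigcup_(t in [set` A]) Q l t) = #|A|%:R * p l.
Proof.
move=> AU; rewrite fine_probability_bigcup//; last first.
  by move=> i j x _ _; exact: Qdisj.
rewrite (eq_bigr (fun=> p l)); last by move=> t tA; rewrite Qmass//; exact: AU.
by rewrite sumr_const mulr_natl.
Qed.

Definition subcells g (u : T g) j : {set T j} :=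
  [set t | `[< Q j t `<=` Q g u >]].

Lemma subcellsP g u j t : reflect (Q j t `<=` Q g u) (t \in subcells g u j).
Proof. by rewrite inE; exact: asboolP. Qed.

(** Disjointness gives this bound at every level, including those below [g], over which the greedy
    selection also runs. *)
Lemma subcells_mass_le g u j : Q g u `<=` U -> #|subcells g u j|%:R * p j <= p g.
Proof.
move=> uU; rewrite -cells_mass => [|t /subcellsP/subset_trans]; last exact.
rewrite -(Qmass _ _ uU) le_fine_probability//.
- by apply: fin_bigcup_measurable.
- by move=> y [t /= /subcellsP]; exact.
Qed.

Lemma subcells_mass g u j : (g <= j)%N -> Q g u `<=` U ->
  #|subcells g u j|%:R * p j = p g.
Proof.
move=> gj uU; apply/eqP; rewrite eq_le subcells_mass_le//=.
rewrite -cells_mass => [|t /subcellsP/subset_trans]; last exact.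
rewrite -(Qmass _ _ uU) le_fine_probability//.
  by apply: fin_bigcup_measurable.
move=> y Qy; have [t Qt] := Qcover j _ (uU _ Qy).
by exists t => //=; apply/subcellsP; exact: (Qnest _ _ _ _ _ gj Qt Qy).
Qed.

(** * Growth of the union of small cells around points of hit subcells *)

Section greedy.
Variables (g : nat) (u : T g) (k : nat -> nat).
Variables (H : forall j, {set T j}) (z : forall j, T j -> W).
Hypothesis uU : Q g u `<=` U.
Hypothesis k_ge : forall j, (j <= k j)%N.
Hypothesis Hsub : forall j t, t \in H j -> t \in subcells g u j.
Hypothesis Hz : forall j t, t \in H j -> Q j t (z j t).

(** [z j t] stands for a point of the sequence in the hit subcell [t]; its cell of level [k j] is
    the part kept of the ball around it. *)
Definition hit_cells j := \bigcup_(t in [set` H j]) point_cell (k j) (z j t).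
Definition hit_union n := \bigcup_(i in [set i | (i < n)%N]) hit_cells i.

Let HU j t : t \in H j -> Q j t `<=` U.
Proof. by move=> /Hsub/subcellsP/subset_trans; exact. Qed.

Let measurable_hit_cells j : measurable (hit_cells j).
Proof. by apply: fin_bigcup_measurable => // t _; exact: measurable_point_cell. Qed.

Lemma measurable_hit_union n : measurable (hit_union n).
Proof. by apply: bigcup_measurable. Qed.

Lemma hit_union_sub n : hit_union n `<=` Q g u.
Proof.
move=> y [i _ [t /= tH]]; have /subcellsP tu := Hsub _ _ tH.
by move=> /(point_cell_nest _ _ _ _ (k_ge i) (Hz _ _ tH))/tu.
Qed.

(* A level-[j] cell meeting an earlier selected cell lies inside it or
   contains it; the second alternative costs at most [p g / 4] because there
   are at most [q ^- (i - g)] selected cells of level [i]. *)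
Let shadow i j := \bigcup_(t in [set` H i]) point_cell j (z i t).
Let blocked j :=
  hit_union j `|` \bigcup_(i in [set` [set: 'I_j]%SET]) shadow i j.

Let measurable_shadow i j : measurable (shadow i j).
Proof. by apply: fin_bigcup_measurable => // t _; exact: measurable_point_cell. Qed.

Let shadow_mass i j : (i <= j)%N -> m (shadow i j) <= p g * q ^+ (j - i).
Proof.
move=> ij; apply: le_trans (fine_probability_bigcup_le _ _ _ _ _) _.
  by move=> t _; exact: measurable_point_cell.
rewrite (eq_bigr (fun=> p j)); last first.
  by move=> t tH; exact: (point_cell_mass _ _ _ _ ij (HU _ _ tH) (Hz _ _ tH)).
rewrite sumr_const -mulr_natl -{1}(subnKC ij) exprD !mulrA.
rewrite ler_wpM2r ?exprn_ge0//.
rewrite -mulrA; apply: le_trans (subcells_mass_le _ _ i uU).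
rewrite ler_wpM2r//.
by rewrite ler_nat subset_leq_card//; apply/fintype.subsetP => t; exact: Hsub.
Qed.

Let blocked_mass j : m (blocked j) <= m (hit_union j) + p g / 4.
Proof.
have mshadows : measurable (\bigcup_(i in [set` [set: 'I_j]%SET]) shadow i j).
  by apply: fin_bigcup_measurable.
apply: le_trans (fine_probabilityU_le _ _ _ (measurable_hit_union j) mshadows) _.
rewrite lerD2l; apply: le_trans (fine_probability_bigcup_le _ _ _ _ _) _.
  by move=> i _; exact: measurable_shadow.
apply: (@le_trans _ _ (\sum_(i < j) p g * q ^+ (j - i))).
  rewrite big_set/=; apply: ler_sum => i _.
  by apply: shadow_mass; exact: ltnW.
rewrite -mulr_sumr ler_wpM2l//.
by apply: sum_expr_le_quarter; case/andP: q_itv => /ltW -> ->.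
Qed.

Let blocked_cell j t : t \in H j -> Q j t `&` hit_union j !=set0 ->
  Q j t `<=` blocked j.
Proof.
move=> tH [y [Qy [i /= ij [t' t'H [s Qsz Qsy]]]]].
have [kj|jk] := leqP (k i) j => x Qx.
  left; exists i => //; exists t' => //; exists s => //.
  exact: (Qnest _ _ _ _ _ kj Qy Qsy).
right; exists (Ordinal ij); first by rewrite /= inE.
exists t' => //; exists t => //.
exact: (Qnest _ _ _ _ _ (ltnW jk) Qsy Qy).
Qed.

(** The hit subcells disjoint from the union so far have total mass at least
    [p g / 2 - m (hit_union j) - p g / 4], because the others lie in [blocked j]. Each of them adds
    a new cell of relative mass [q ^+ (k j - j)]. *)
Lemma hit_union_step j : p g / 2 <= #|H j|%:R * p j ->
  m (hit_union j) + q ^+ (k j - j) * (p g / 4 - m (hit_union j)) <=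
  m (hit_union j.+1).
Proof.
move=> Hbig.
pose H' := [set t in H j | `[< Q j t `&` hit_union j = set0 >]].
have H'H t : t \in H' -> t \in H j by rewrite inE => /andP[].
pose new := \bigcup_(t in [set` H']) point_cell (k j) (z j t).
have mnew : measurable new.
  by apply: fin_bigcup_measurable => // t _; exact: measurable_point_cell.
have mcells A : measurable (\bigcup_(t in [set` A]) Q j t).
  by apply: fin_bigcup_measurable.
have mblocked : measurable (blocked j).
  apply: measurableU; [exact: measurable_hit_union|].
  by apply: fin_bigcup_measurable => // i _; exact: measurable_shadow.
have new_mass : m new = #|H'|%:R * p j * q ^+ (k j - j).
  rewrite fine_probability_bigcup; last 2 first.
  - by move=> t _; exact: measurable_point_cell.
  - move=> t t' y /H'H tH /H'H t'H yt yt'; apply: Qdisj.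
      exact: (point_cell_nest _ _ _ _ (k_ge j) (Hz _ _ tH) _ yt).
    exact: (point_cell_nest _ _ _ _ (k_ge j) (Hz _ _ t'H) _ yt').
  rewrite (eq_bigr (fun=> p (k j))); last first.
    move=> t /H'H tH.
    exact: (point_cell_mass _ _ _ _ (k_ge j) (HU _ _ tH) (Hz _ _ tH)).
  by rewrite sumr_const -[LHS]mulr_natl -{1}(subnKC (k_ge j)) exprD !mulrA.
have disj : hit_union j `&` new = set0.
  apply/seteqP; split=> // y [Wy [t /= tH' yt]].
  move: (tH'); rewrite inE => /andP[tH /asboolP tW].
  suff : (Q j t `&` hit_union j) y by rewrite tW.
  by split=> //; exact: (point_cell_nest _ _ _ _ (k_ge j) (Hz _ _ tH) _ yt).
have step : m (hit_union j) + m new <= m (hit_union j.+1).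
  rewrite -fine_probabilityU//; last exact: measurable_hit_union.
  apply: le_fine_probability.
  - by apply: measurableU => //; exact: measurable_hit_union.
  - exact: measurable_hit_union.
  - move=> y [[i /= ij iy]|[t /= /H'H tH yt]].
      by exists i => //=; rewrite ltnS ltnW.
    by exists j => //=; exists t.
apply: le_trans step; rewrite lerD2l new_mass mulrC.
rewrite ler_wpM2r ?exprn_ge0//.
have : #|H j|%:R * p j <= #|H'|%:R * p j + m (blocked j).
  rewrite -!cells_mass; last 2 first.
  - by move=> t /H'H; exact: HU.
  - by move=> t; exact: HU.
  apply: le_trans (fine_probabilityU_le _ _ _ _ _) => //.
  apply: le_fine_probability => //; first exact: measurableU.
  move=> y [t /= tH Qy].
  have [tW|/set0P tW] := eqVneq (Q j t `&` hit_union j) set0.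
    by left; exists t => //=; rewrite inE tH; apply/asboolP.
  by right; exact: (blocked_cell _ _ tH).
have := blocked_mass j; lra.
Qed.

(** While the union has mass at most [p g / 8], each step from [j0] on gains at least [p g / 8]
    times [q ^+ (k j - j)], and these gains have unbounded sum. *)
Lemma hit_union_large j0 :
  (forall j, (j0 <= j)%N -> p g / 2 <= #|H j|%:R * p j) ->
  (forall B, exists n, B < \sum_(j < n) q ^+ (k j - j)) ->
  0 < p0 -> exists n, p g / 8 < m (hit_union n).
Proof.
move=> Hbig div p0_gt0; apply/not_existsP => small.
have {}small n : m (hit_union n) <= p g / 8 by rewrite leNgt; apply/negP.
have pg : 0 < p g by rewrite mulr_gt0// exprn_gt0//; case/andP: q_itv.
have th j : 0 <= q ^+ (k j - j) <= 1.
  by rewrite exprn_ge0 ?exprn_ile1//; have := q_itv; lra.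
(* The terms are at most 1, so subtracting [j0] absorbs the levels below [j0], where [Hbig] says
   nothing. *)
have low n : p g / 8 * (\sum_(j < n) q ^+ (k j - j) - j0%:R) <= m (hit_union n).
  elim: n => [|n IH].
    rewrite big_ord0; apply: le_trans (fine_probability_ge0 _ _).
    by rewrite sub0r mulrN oppr_le0 mulr_ge0//; lra.
  have [j0n|nj0] := leqP j0 n; last first.
    apply: le_trans (fine_probability_ge0 _ _).
    rewrite pmulr_rle0; last lra.
    rewrite subr_le0; apply: (@le_trans _ _ n.+1%:R); last by rewrite ler_nat.
    rewrite -[n.+1 in leRHS]card_ord -sum1_card natr_sum.
    by apply: ler_sum => i _; case/andP: (th i).
  have := hit_union_step n (Hbig _ j0n).
  rewrite big_ord_recr/=.
  set s := \sum_(_ < _) _ in IH *; set t := q ^+ _.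
  have : t * (p g / 8) <= t * (p g / 4 - m (hit_union n)).
    rewrite ler_wpM2l//; first by case/andP: (th n).
    by have := small n; lra.
  set a := p g in IH *; lra.
have [n] := div (j0%:R + 1); have := low n; have := small n.
set s := \sum_(_ < _) _ => sm lo ns.
have : p g / 8 * 1 < p g / 8 * (s - j0%:R) by rewrite ltr_pM2l//; lra.
lra.
Qed.

End greedy.

(** * Null sets from a uniform density gap; [cell_in_U] and [cell_off_F] encode [U] open and [F]
    closed *)

Section null_set.
Variables (F : set W) (c : R).
Hypothesis mF : measurable F.
Hypothesis mU : measurable U.
Hypothesis cell_in_U : forall y, U y ->
  exists k0, forall k, (k0 <= k)%N -> point_cell k y `<=` U.
Hypothesis cell_off_F : forall y, U y -> ~ F y ->
  exists k0, forall k, (k0 <= k)%N -> point_cell k y `<=` ~` F.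
Hypothesis c_itv : 0 <= c < 1.
Hypothesis thin : forall k t, Q k t `<=` U -> m (F `&` Q k t) <= c * m (Q k t).

(* A dyadic substitute for the Lebesgue density theorem: the union [O] of the
   level-[k] cells inside [U] that meet [F] differs from [F `&` U] by a set
   [Z] whose measure vanishes as [k] grows. *)
Lemma thin_set_null : mu (F `&` U) = 0%E.
Proof.
pose V k : {set T k} := [set t | `[< Q k t `<=` U >]]%SET.
pose A k : {set T k} := [set t in V k | `[< Q k t `&` F !=set0 >]]%SET.
pose O k := \bigcup_(t in [set` A k]) Q k t.
pose Z k := (U `\` \bigcup_(t in [set` V k]) Q k t) `|` (O k `\` F).
have mcells k (B : {set T k}) : measurable (\bigcup_(t in [set` B]) Q k t).
  by apply: fin_bigcup_measurable.
have mO k : measurable (O k) := mcells k (A k).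
have mFU : measurable (F `&` U) by exact: measurableI.
have mZ k : measurable (Z k).
  by apply: measurableU; apply: measurableD.
have AU k t : t \in A k -> Q k t `<=` U.
  by rewrite !inE => /andP[/asboolP].
have OU k : O k `<=` U by move=> y [t /= /AU]; exact.
(* The small cells around a point of [U] end up inside [U], and those around a point of [U] off [F]
   end up missing [F]. *)
have outZ y : exists k0, forall k, (k0 <= k)%N -> ~ Z k y.
  have [Uy|nUy] := pselect (U y); last first.
    by exists 0%N => k _ [[/nUy]//|[/OU/nUy]].
  have [k1 inU] := cell_in_U _ Uy.
  have [k2 offF] : exists k2, forall k, (k2 <= k)%N -> ~ (O k `\` F) y.
    have [Fy|nFy] := pselect (F y); first by exists 0%N => k _ [_ /(_ Fy)].
    have [k2 off] := cell_off_F _ Uy nFy; exists k2 => k k2k.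
    move=> [[t /=]]; rewrite inE => /andP[_ /asboolP[x [Qx Fx]]] Qy _.
    by apply: (off k k2k x) => //; exists t.
  exists (maxn k1 k2) => k; rewrite geq_max => /andP[k1k k2k] [[_ nV]|].
    apply: nV; have [t Qt] := Qcover k _ Uy; exists t => //=.
    rewrite inE; apply/asboolP.
    by rewrite -(point_cellE _ _ _ Qt); exact: inU.
  exact: offF.
(* With [f], [o], [z] the masses of [F] in [U], of [O k] and of [Z k]: [f <= c o + z] and
   [o <= f + z], hence [f <= c f + 2 z] as [c <= 1]. *)
have bound k : (1 - c) * m (F `&` U) <= 2 * m (Z k).
  have le1 : m (F `&` U) <= m (F `&` O k) + m (Z k).
    apply: le_trans (fine_probabilityU_le _ _ _ _ _) => //; last exact: measurableI.
    apply: le_fine_probability => //.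
      by apply: measurableU => //; exact: measurableI.
    move=> y [Fy Uy].
    have [[t /= tV Qt]|nV] := pselect ((\bigcup_(t in [set` V k]) Q k t) y).
      left; split=> //; exists t => //=; rewrite inE tV.
      by apply/asboolP; exists y.
    by right; left.
  have le2 : m (O k) <= m (F `&` U) + m (Z k).
    apply: le_trans (fine_probabilityU_le _ _ _ _ _) => //.
    apply: le_fine_probability => //; first exact: measurableU.
    move=> y Oy; have [Fy|nFy] := pselect (F y); last by right; right.
    by left; split => //; exact: OU Oy.
  have le3 : m (F `&` O k) <= c * m (O k).
    rewrite setI_bigcupr !fine_probability_bigcup//; last 3 first.
    - by move=> i j y _ _; exact: Qdisj.
    - by move=> i _; exact: measurableI.
    - by move=> i j y _ _ [_ Qi] [_]; exact: Qdisj.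
    by rewrite mulr_sumr; apply: ler_sum => t tA; exact: thin (AU _ _ tA).
  have : c * m (O k) <= c * (m (F `&` U) + m (Z k)).
    by rewrite ler_wpM2l//; case/andP: c_itv.
  have : c * m (Z k) <= m (Z k).
    by rewrite ler_piMl ?fine_probability_ge0//; case/andP: c_itv => _ /ltW.
  move: le1 le2 le3; set f := m (F `&` U); set z := m (Z k); set o := m (O k).
  set fo := m (F `&` O k); lra.
rewrite -(fine_probabilityK mu _ mFU); congr (_%:E).
apply/eqP; rewrite eq_le fine_probability_ge0 andbT leNgt; apply/negP => f0.
have f0' : 0 < (1 - c) * m (F `&` U) / 2.
  by rewrite !mulr_gt0// ?invr_gt0// subr_gt0; case/andP: c_itv.
have [k zk] := fine_probability_small mu _ _ mZ outZ f0'.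
by have := bound k; lra.
Qed.

End null_set.

(** * Blocks of points that hit half of the subcells *)

Section hits.
Variables (M D : nat) (g : nat) (u : T g).
Hypothesis uU : Q g u `<=` U.
Hypothesis qD : q = D%:R^-1.
Hypothesis p0_gt0 : 0 < p0.

(** The length grows like the number of level-[j] cells. The excluded upper end is the index at
    which [radii_seq_condense] samples the radii, so all radii of the block are at least the sampled
    one. *)
Definition block j : set nat := [set n | (M * D ^ j <= n < M * D ^ j + M * D ^ j)%N].

Definition hits (x : nat -> W) j : {set T j} :=
  [set t in subcells g u j | `[< exists2 n, block j n & Q j t (x n) >]].

Let D_ge8 : (8 <= D)%N.
Proof.
move: q_itv; rewrite qD => /andP[D0]; rewrite lef_pV2 ?ler_nat// posrE//.
by rewrite -invr_gt0.
Qed.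

(** The expected number of block points in a level-[j] cell inside [U] is the same at all levels. *)
Let p_block j : p j * (M * D ^ j)%:R = M%:R * p0.
Proof.
rewrite qD natrM natrX exprVn; field.
by rewrite expf_neq0// pnatr_eq0; case: D D_ge8.
Qed.

Let card_subcells j : (g <= j)%N -> #|subcells g u j| = (D ^ (j - g))%N.
Proof.
move=> gj; apply/eqP; rewrite -(eqr_nat R).
have pj0 : p j != 0 by rewrite mulf_neq0 ?expf_neq0 ?gt_eqF//; case/andP: q_itv.
rewrite -(inj_eq (mulIf pj0)) subcells_mass//.
have D0 : D%:R != 0 :> R by rewrite pnatr_eq0; case: D D_ge8.
rewrite mulrCA; apply/eqP; congr (_ * _).
by rewrite -{2}(subnKC gj) exprD qD natrX !exprVn mulrCA divff ?mulr1 ?expf_neq0.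
Qed.

Section almost_surely.
Context {dT : measure_display} {Om : measurableType dT}.
Variables (P : probability Om R) (X : nat -> Om -> W).
Hypothesis mX : forall n B, measurable B -> measurable (X n @^-1` B).
Hypothesis iid : forall B a n, measurable B ->
  P (\bigcap_(i in [set i | (a <= i < a + n)%N]) X i @^-1` B) = (m B ^+ n)%:E.
Hypothesis M_large : 4 <= M%:R * p0.

Let cells j (S : {set T j}) := \bigcup_(t in [set` S]) Q j t.

Let missed j (S : {set T j}) := \bigcap_(i in block j) X i @^-1` (~` cells j S).

Let unlucky j := \bigcup_(S in
  [set` [set S in powerset (subcells g u j) | (#|subcells g u j| <= 2 * #|S|)%N]%SET])
  missed j S.

Let mcells j (S : {set T j}) : measurable (cells j S).
Proof. exact: fin_bigcup_measurable. Qed.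

Let block_neq0 j : block j !=set0.
Proof.
exists (M * D ^ j)%N; rewrite /block/= leqnn/= -{1}[(M * D ^ j)%N]addn0 ltn_add2l.
rewrite muln_gt0 expn_gt0 (leq_trans _ D_ge8)// andbT lt0n.
by apply/eqP => M0; move: M_large; rewrite M0 mul0r; lra.
Qed.

Let mmissed j (S : {set T j}) : measurable (missed j S).
Proof.
by apply: bigcap_measurable => // n _; apply: mX; exact: measurableC.
Qed.

Let munlucky j : measurable (unlucky j).
Proof. exact: fin_bigcup_measurable. Qed.

(** With [n] subcells, [1 - x <= expR (- x)] bounds the probability by [expR (- #|S| M p0)];
    [#|S| >= n / 2] and [M p0 >= 4] leave [expR (- 2 n) <= 4 ^ - n]. The base 4 outweighs the
    [2 ^ n] choices of [S]. *)
Let missed_mass j (S : {set T j}) : S \subset subcells g u j ->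
  (#|subcells g u j| <= 2 * #|S|)%N ->
  fine (P (missed j S)) <= 4^-1 ^+ #|subcells g u j|.
Proof.
move=> Ssub Slarge; rewrite /missed iid/=; last exact: measurableC.
have mS : m (~` cells j S) = 1 - #|S|%:R * p j.
  rewrite probability_setC// fineB ?fin_num_measure// cells_mass//.
  by move=> t /(fintype.subsetP Ssub)/subcellsP/subset_trans; exact.
apply: (@le_trans _ _ (expR (- (#|S|%:R * p j)) ^+ (M * D ^ j))).
  rewrite lerXn2r ?nnegrE ?expR_ge0 ?fine_probability_ge0// mS.
  exact: expR_ge1Dx.
rewrite -expRM_natr mulNr -mulrA p_block.
apply: (@le_trans _ _ (expR (#|subcells g u j|%:R * -2))).
  rewrite ler_expR mulrN lerN2 mulrC.
  have : 2 * #|subcells g u j|%:R <= 4 * #|S|%:R :> R.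
    by rewrite -!natrM ler_nat; lia.
  have : 4 * #|S|%:R <= #|S|%:R * (M%:R * p0) by rewrite mulrC ler_wpM2l.
  lra.
rewrite expRM_natl lerXn2r ?nnegrE ?expR_ge0//.
rewrite expRN lef_pV2 ?posrE ?expR_gt0//.
have e1 : 2 <= expR 1 :> R by have := expR_ge1Dx (1 : R); lra.
have -> : 2 = 2%:R * 1 :> R by rewrite mulr1.
rewrite expRM_natl; apply: (@le_trans _ _ (2 ^+ 2)); first by rewrite expr2; lra.
by rewrite lerXn2r ?nnegrE//; lra.
Qed.

(* Union bound over the at most [2 ^ #|subcells g u j|] sets of missed cells. *)
Let unlucky_mass j : fine (P (unlucky j)) <= 2^-1 ^+ #|subcells g u j|.
Proof.
apply: le_trans (fine_probability_bigcup_le _ _ _ _ _) _ => //.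
apply: (@le_trans _ _ (\sum_(S in powerset (subcells g u j))
                         4^-1 ^+ #|subcells g u j|)).
  rewrite [leRHS](bigID (fun S : {set T j} =>
    (#|subcells g u j| <= 2 * #|S|)%N))/=.
  rewrite ler_wpDr//; first by apply: sumr_ge0 => S _; rewrite exprn_ge0.
  rewrite (eq_bigl (fun S => (S \in powerset (subcells g u j)) &&
    (#|subcells g u j| <= 2 * #|S|)%N)); last by move=> S; rewrite inE.
  apply: ler_sum => S /andP[]; rewrite powersetE; exact: missed_mass.
rewrite sumr_const card_powerset -[leLHS]mulr_natl natrX -exprMn.
by rewrite lerXn2r ?nnegrE//; lra.
Qed.

Let unlucky_null : P (lim_sup_set unlucky) = 0%E.
Proof.
apply: lim_sup_set_cvg0 => //.
(* The bound [2 ^ g / 2 ^ j] exceeds 1 for [j < g]; for [j >= g] it works because there are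
   [D ^ (j - g) > j - g] subcells. The extra factor 2 fits the form of the geometric series. *)
pose c : R := 2 ^+ g * 2.
have bound j : (P (unlucky j) <= (c / (2 ^ (j + 1))%:R)%:E)%E.
  rewrite -fine_probabilityK// lee_fin.
  have -> : c / (2 ^ (j + 1))%:R = 2 ^+ g / 2 ^+ j :> R.
    by rewrite natrX addn1 exprS /c; field; rewrite expf_neq0.
  have [gj|jg] := leqP g j; last first.
    apply: (@le_trans _ _ 1); first exact: fine_probability_le1.
    by rewrite ler_pdivlMr ?exprn_gt0// mul1r ler_eXn2l ?(ltnW jg)// ltr1n.
  apply: le_trans (unlucky_mass j) _.
  have -> : 2 ^+ g / 2 ^+ j = 2^-1 ^+ (j - g) :> R.
    rewrite -{1}(subnKC gj) exprD invfM mulrA divff ?expf_neq0// mul1r.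
    by rewrite exprVn.
  apply: ler_wiXn2l; [by rewrite invr_ge0|by rewrite invf_le1 ?ler1n|].
  by rewrite card_subcells// ltnW// ltn_expl// (leq_trans _ D_ge8).
apply: (@le_lt_trans _ _ (\sum_(0 <= j <oo) (c / (2 ^ (j + 1))%:R)%:E)%E).
  by apply: lee_nneseries => [i _ _|j _]; [exact: measure_ge0|exact: bound].
have /cvg_lim -> // := @cvg_geometric_eseries_half R c 0.
by rewrite ltry.
Qed.

Lemma ae_many_hits : {ae P, forall w, exists j0, forall j, (j0 <= j)%N ->
  p g / 2 <= #|hits (fun n => X n w) j|%:R * p j}.
Proof.
exists (lim_sup_set unlucky); split=> //.
  apply: bigcap_measurable => // k _; exact: bigcup_measurable.
move=> w /= few n _; apply: contrapT => lucky; apply: few.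
(* From level [g] on the subcells fill [Q g u], so half of their number means half of its mass. *)
exists (maxn n g) => j; rewrite geq_max => /andP[nj gj].
pose S := subcells g u j :\: hits (fun n => X n w) j.
have card_hits : (#|hits (fun n => X n w) j| + #|S| = #|subcells g u j|)%N.
  rewrite -(cardsID (hits (fun n => X n w) j) (subcells g u j)).
  congr (_ + _)%N; congr #|pred_of_set _|; apply/esym/finset.setIidPr.
  by apply/fintype.subsetP => t; rewrite inE => /andP[].
have Ssmall : (2 * #|S| < #|subcells g u j|)%N.
  rewrite ltnNge; apply/negP => Slarge; apply: lucky.
  exists j => //; exists S => /=.
    by rewrite inE Slarge powersetE finset.subsetDl.
  move=> i ji [t /= tS Qt]; move: tS; rewrite !inE => /andP[/negP nt tsub].
  by apply: nt; rewrite tsub; apply/asboolP; exists i.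
rewrite -(subcells_mass _ _ _ gj uU) -mulrAC ler_wpM2r// ler_pdivrMr//.
by rewrite -natrM ler_nat; lia.
Qed.

End almost_surely.

(** [F] avoids the small cells around the points of the blocks, and these fill more than an eighth
    of [Q g u]. *)
Lemma hits_thin (x : nat -> W) (k : nat -> nat) (F : set W) (j0 : nat) :
  measurable F ->
  (forall j, (j0 <= j)%N -> p g / 2 <= #|hits x j|%:R * p j) ->
  (forall j, (j <= k j)%N) ->
  (forall B, exists n, B < \sum_(j < n) q ^+ (k j - j)) ->
  (forall j n, (j0 <= j)%N -> block j n -> point_cell (k j) (x n) `<=` ~` F) ->
  m (F `&` Q g u) <= 7 / 8 * m (Q g u).
Proof.
move=> mF many k_ge div off.
(* Below [j0] nothing keeps the small cells off [F], so no subcell is selected there. *)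
pose H j : {set T j} := if (j0 <= j)%N then hits x j else finset.set0.
have Hhits j t : t \in H j -> (j0 <= j)%N /\ t \in hits x j.
  by rewrite /H; case: leqP => //; rewrite inE.
(* The default index 0 is harmless: a hit subcell contains a point of the block. *)
pose z j t := x (xget 0%N [set n | block j n /\ Q j t (x n)]).
have Hz j t : t \in H j -> exists n, [/\ z j t = x n, block j n & Q j t (x n)].
  move=> /Hhits[_]; rewrite inE => /andP[_ /asboolP[n bn Qn]].
  have : block j (xget 0%N [set n | block j n /\ Q j t (x n)]) /\
      Q j t (x (xget 0%N [set n | block j n /\ Q j t (x n)])).
    by apply: (@xgetPex _ 0%N [set n | block j n /\ Q j t (x n)]); exists n.
  by move=> [bz Qz]; exists (xget 0%N [set n | block j n /\ Q j t (x n)]).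
have Hsub j t : t \in H j -> t \in subcells g u j.
  by move=> /Hhits[_]; rewrite inE => /andP[].
have Hzz j t : t \in H j -> Q j t (z j t).
  by move=> /Hz[n [-> _]].
have Hmany j : (j0 <= j)%N -> p g / 2 <= #|H j|%:R * p j.
  by move=> j0j; rewrite /H j0j; exact: many.
have [n] := hit_union_large _ _ _ _ z uU k_ge Hsub Hzz j0 Hmany div p0_gt0.
set E := hit_union _ _ _ _ => En.
have mE : measurable E by exact: measurable_hit_union.
have EF : (F `&` Q g u) `&` E = set0.
  apply/seteqP; split=> // y [[Fy _] [i _ [t /= tH]]].
  have [l [-> bl _]] := Hz _ _ tH.
  by move=> /(off _ _ (Hhits _ _ tH).1 bl); exact.
have : m (F `&` Q g u) + m E <= m (Q g u).
  rewrite -fine_probabilityU//; last exact: measurableI.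
  apply: le_fine_probability => //.
    by apply: measurableU => //; exact: measurableI.
  by move=> y [[]|/(hit_union_sub _ _ _ _ _ k_ge Hsub Hzz)].
by rewrite (Qmass _ _ uU); lra.
Qed.

End hits.

End cell_tree.

(** * Condensation of the radii *)

(** Partial sums increase, so bounding arbitrarily late ones suffices; condensation controls them at
    block ends. *)
Lemma nneseries_le_bound (R : realType) (f : nat -> R) (B : R) :
  (forall n, 0 <= f n) ->
  (forall N, exists2 n, (N <= n)%N & \sum_(0 <= i < n) f i <= B) ->
  (\sum_(0 <= n <oo) (f n)%:E <= B%:E)%E.
Proof.
move=> f0 fB; apply: lime_le.
  by apply: is_cvg_nneseries => n _ _; rewrite lee_fin.
apply: nearW => N; rewrite sumEFin lee_fin; have [n Nn] := fB N.
apply: le_trans; rewrite (@big_cat_nat _ _ _ N 0 n)//= lerDl.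
by apply: sumr_ge0.
Qed.

Section condensation.
Context {R : realType} (d : nat) (r : nat -> R).
Hypothesis d0 : (0 < d)%N.
Hypothesis rP : radii_seq d r.

Lemma radii_seq_le (i j : nat) : (i <= j)%N -> r j <= r i.
Proof.
case: rP => rS _ _; elim: j => [|j IH]; first by rewrite leqn0 => /eqP ->.
rewrite leq_eqVlt ltnS => /predU1P[->//|/IH]; exact: le_trans.
Qed.

Lemma radii_seq_ge0 n : 0 <= r n.
Proof.
case: rP => _ r0 _; rewrite -(cvg_lim _ r0)//.
apply: limr_le; first exact: (cvgP _ r0).
by exists n => // m /= nm; exact: radii_seq_le.
Qed.

(** A zero radius would make all later ones vanish, and with [d > 0] the series would be a finite
    sum. *)
Lemma radii_seq_gt0 n : 0 < r n.
Proof.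
rewrite lt_neqAle radii_seq_ge0 andbT eq_sym; apply/eqP => rn0.
case: rP => _ _; apply/eqP; rewrite lt_eqF//.
apply: le_lt_trans (ltry (\sum_(0 <= i < n) r i ^+ d)).
apply: nneseries_le_bound => [i|N]; first by rewrite exprn_ge0// radii_seq_ge0.
exists (n + N)%N; first exact: leq_addl.
rewrite (@big_cat_nat _ _ _ n 0 (n + N)) ?leq_addr//= gerDl.
rewrite big_nat big1// => i /andP[ni _].
have -> : r i = 0.
  by apply/eqP; rewrite eq_le radii_seq_ge0 -rn0 radii_seq_le.
by rewrite expr0n eqn0Ngt d0.
Qed.

(* Cauchy condensation along [n = 2 M 8 ^ (d j)]; the radius at that index is
   rounded down to a scale [s / 8 ^ k j] with [k j >= j]. *)
Lemma radii_seq_condense (M : nat) (s : R) : (0 < M)%N -> 0 < s ->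
  exists k : nat -> nat, [/\ forall j, (j <= k j)%N,
    forall j, s * 8^-1 ^+ k j <= r (M * (8 ^ d) ^ j + M * (8 ^ d) ^ j)%N &
    forall B, exists n, B < \sum_(j < n) ((8 ^ d)%:R^-1 : R) ^+ (k j - j)].
Proof.
move=> M0 s0; set D := (8 ^ d)%N.
have D0 : (0 < D)%N by rewrite expn_gt0.
have DR0 : D%:R != 0 :> R by rewrite pnatr_eq0 -lt0n.
pose a j := (M * D ^ j + M * D ^ j)%N.
have exk j : exists k, (j <= k)%N && (s * 8^-1 ^+ k <= r (a j)).
  have ra := radii_seq_gt0 (a j).
  pose b := Num.trunc (s / r (a j)); exists (j + b.+1)%N; rewrite leq_addr/=.
  rewrite exprVn ler_pdivrMr ?exprn_gt0// mulrC -ler_pdivrMr//.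
  have /truncn_itv/andP[_ /ltW sb] : 0 <= s / r (a j) by rewrite divr_ge0// ltW.
  apply: le_trans sb _; rewrite -natrX ler_nat.
  apply: (@leq_trans (2 ^ (j + b.+1))); last by rewrite leq_exp2r// addnS.
  by apply: leq_trans (ltnW (ltn_expl _ _)) => //; rewrite leq_addl.
pose k j := ex_minn (exk j).
have kP j : [/\ (j <= k j)%N, s * 8^-1 ^+ k j <= r (a j) &
    forall i, (j <= i)%N -> s * 8^-1 ^+ i <= r (a j) -> (k j <= i)%N].
  rewrite /k; case: ex_minnP => i /andP[ji si] imin; split=> // i' ji' si'.
  by apply: imin; rewrite ji'.
exists k; split=> [j|j|]; [by case: (kP j)|by case: (kP j)|].
pose th j : R := D%:R^-1 ^+ (k j - j).
have th0 j : 0 <= th j by rewrite exprn_ge0// invr_ge0.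
apply/not_forallP => -[B] /forallNP bnd.
have {}bnd n : \sum_(j < n) th j <= B by rewrite leNgt; apply/negP/bnd.
(* Bounded sums force the terms to 0. A term below 1 excludes [k j = j], so minimality applies to
   [(k j).-1] and bounds the radius from above. *)
have cvth : cvgn (series th).
  apply: nondecreasing_is_cvgn.
    by apply/nondecreasing_seqP => n; rewrite /series/= big_nat_recr//= lerDl.
  by exists B => _ [n _ <-]; rewrite /series/= big_mkord.
have [j1 _ th1] : \forall j \near \oo, th j < 1.
  by apply: (cvgr_lt 0 (cvg_series_cvg_0 cvth)); exact: ltr01.
have ltk j : (j1 <= j)%N -> (j < k j)%N.
  move=> jj; case: (kP j) => kj _ _; rewrite ltn_neqAle kj andbT.
  apply/eqP => ejk; have := th1 j jj; rewrite /th/= -ejk subnn expr0.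
  by rewrite ltxx.
have key j : (j1 <= j)%N -> D%:R ^+ j * r (a j) ^+ d <= s ^+ d * D%:R * th j.
  move=> /ltk jk; case: (kP j) => _ _ kmin.
  have lt_r : r (a j) <= s * 8^-1 ^+ (k j).-1.
    rewrite leNgt; apply/negP => /ltW le_r.
    by have := kmin (k j).-1 _ le_r; lia.
  have -> : s ^+ d * D%:R * th j = D%:R ^+ j * (s * 8^-1 ^+ (k j).-1) ^+ d.
    have q8 : 8^-1 ^+ d = D%:R^-1 :> R by rewrite exprVn -natrX.
    rewrite exprMn exprAC q8.
    have ek : (k j).-1 = (j + (k j - j).-1)%N by lia.
    have ek' : (k j - j = (k j - j).-1.+1)%N by lia.
    rewrite /th ek' ek exprD exprS !exprVn; field.
    by rewrite !expf_neq0.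
  by rewrite ler_wpM2l ?exprn_ge0// lerXn2r ?nnegrE ?radii_seq_ge0//
    mulr_ge0 ?exprn_ge0// ltW.
pose K := \sum_(0 <= n < a j1) r n ^+ d.
(* [(M + M) D D ^ J] is [a J.+1], which bounds the number of indices from [a J] to [a J.+1]; the
   factor [s ^ d D] comes from [key]. *)
pose L : R := (M + M)%:R * D%:R * (s ^+ d * D%:R).
have L0 : 0 <= L by rewrite !mulr_ge0// exprn_ge0// ltW.
have part J : (j1 <= J)%N ->
    \sum_(0 <= n < a J) r n ^+ d <= K + L * \sum_(j < J) th j.
  elim: J => [|J IH].
    by rewrite leqn0 => /eqP j10; rewrite /K j10 big_ord0 mulr0 addr0.
  rewrite leq_eqVlt => /predU1P[<-|].
    by rewrite -/K lerDl mulr_ge0// sumr_ge0.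
  rewrite ltnS => j1J.
  have aJ : (a J <= a J.+1)%N.
    by apply: leq_add; rewrite leq_mul2l expnS leq_pmull ?orbT.
  rewrite (@big_cat_nat _ _ _ (a J))//= big_ord_recr/= mulrDr addrA.
  apply: lerD; first exact: IH.
  apply: (@le_trans _ _ (\sum_(a J <= n < a J.+1) r (a J) ^+ d)).
    rewrite big_nat [leRHS]big_nat; apply: ler_sum => n /andP[an _].
    by rewrite lerXn2r ?nnegrE ?radii_seq_ge0// radii_seq_le.
  rewrite sumr_const_nat -[leLHS]mulr_natl.
  apply: (@le_trans _ _ ((a J.+1)%:R * r (a J) ^+ d)).
    by rewrite ler_wpM2r ?exprn_ge0 ?radii_seq_ge0// ler_nat leq_subr.
  have -> : (a J.+1)%:R = (M + M)%:R * D%:R * D%:R ^+ J :> R.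
    by rewrite /a -mulnDl natrM natrX exprS mulrA.
  rewrite /L -!mulrA ler_wpM2l// ler_wpM2l//.
  by apply: le_trans (key _ j1J) _; rewrite mulrA.
case: rP => _ _; apply/eqP; rewrite lt_eqF//.
apply: le_lt_trans (ltry (K + L * B)).
apply: nneseries_le_bound => [i|N]; first by rewrite exprn_ge0// radii_seq_ge0.
exists (a (N + j1)%N).
  apply: leq_trans (leq_addr _ _); apply: leq_trans (leq_pmull _ M0).
  apply: leq_trans (leq_addr j1 N) _; apply: ltnW.
  by apply: ltn_expl; rewrite -(expn0 8) ltn_exp2l.
apply: le_trans (part _ (leq_addl _ _)) _.
by rewrite lerD2l ler_wpM2l.
Qed.

End condensation.

(** * Scaling of the outer measure and octadic cells *)

Section lebesgue_outer.
Context {R : realType} {d : nat}.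
Implicit Types A B : set 'rV[R]_d.

Lemma box_vol_ge0 (a b : 'rV[R]_d) : 0 <= box_vol a b.
Proof. by apply: prodr_ge0 => i _; rewrite le_max lexx. Qed.

Lemma box_vol_affine (c : R) (v a b : 'rV[R]_d) : 0 < c ->
  box_vol (c *: a + v) (c *: b + v) = c ^+ d * box_vol a b.
Proof.
move=> c0; rewrite /box_vol -[in c ^+ d](card_ord d) -prodr_const -big_split/=.
apply: eq_bigr => i _; rewrite !mxE maxr_pMr ?ltW// mulr0; congr Num.max.
by ring.
Qed.

Lemma lebesgue_outer_ge0 A : (0 <= lebesgue_outer A)%E.
Proof.
apply: le_ereal_inf_tmp => _ [a [b [_ ->]]].
by apply: nneseries_ge0 => n _ _; rewrite lee_fin box_vol_ge0.
Qed.

Lemma le_lebesgue_outer A B : A `<=` B -> (lebesgue_outer A <= lebesgue_outer B)%E.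
Proof.
move=> AB; apply: ereal_inf_le_tmp => _ [a [b [Bab ->]]].
by exists a, b; split=> //; exact: subset_trans Bab.
Qed.

(** The affine map turns a box cover of [A] into one of [B] and multiplies the volumes by
    [c ^ d]. *)
Lemma lebesgue_outer_affine_le (c : R) (v : 'rV[R]_d) A B : 0 < c ->
  (forall y, B y -> exists2 x, A x & y = c *: x + v) ->
  (lebesgue_outer B <= (c ^+ d)%:E * lebesgue_outer A)%E.
Proof.
move=> c0 AB; have cd0 : 0 < c ^+ d by rewrite exprn_gt0.
rewrite -lee_pdivrMl//; apply: le_ereal_inf_tmp => _ [a [b [Aab ->]]].
rewrite lee_pdivrMl//; apply: ereal_inf_lbound.
exists (fun k => c *: a k + v), (fun k => c *: b k + v); split.
  move=> _ /AB[x /Aab[k _ kx] ->]; exists k => // i; rewrite !mxE.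
  by have /andP[ax xb] := kx i; rewrite !lerD2r !ler_pM2l// ax.
rewrite -nneseriesZl; last by move=> n _; rewrite lee_fin box_vol_ge0.
by apply: eq_eseriesr => n _; rewrite box_vol_affine.
Qed.

Lemma lebesgue_outer_affine (c : R) (v : 'rV[R]_d) A : 0 < c ->
  lebesgue_outer [set c *: x + v | x in A] = ((c ^+ d)%:E * lebesgue_outer A)%E.
Proof.
move=> c0; apply/eqP; rewrite eq_le; apply/andP; split.
  by apply: (lebesgue_outer_affine_le c v) => // y [x Ax <-]; exists x.
rewrite -lee_pdivlMl ?exprn_gt0// -exprVn.
apply: (lebesgue_outer_affine_le c^-1 (- (c^-1 *: v))); first by rewrite invr_gt0.
move=> x Ax; exists (c *: x + v); first by exists x.
by rewrite scalerDr scalerA mulVf ?scale1r ?addrK// gt_eqF.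
Qed.

End lebesgue_outer.

Section octadic_cells.
Context {R : realType} {d : nat}.
Variable s : R.
Hypothesis s0 : 0 < s.

(* The level-[l] cells of side [s / 8 ^ l] subdividing the cube [-s/2, s/2)^d. *)
Definition octadic_cell l (t : {ffun 'I_d -> 'I_(8 ^ l)}) : set 'rV[R]_d :=
  [set y | forall i, (t i)%:R <= 8 ^+ l * (y ord0 i / s + 2^-1) < (t i).+1%:R].

Lemma octadic_cell_disj l t u y : octadic_cell l t y -> octadic_cell l u y -> t = u.
Proof.
move=> ty uy; apply/ffunP => i; apply/val_inj => /=.
have /andP[t1 t2] := ty i; have /andP[u1 u2] := uy i.
have : ((t i) < (u i).+1)%N by rewrite -(ltr_nat R); exact: le_lt_trans u2.
have : ((u i) < (t i).+1)%N by rewrite -(ltr_nat R); exact: le_lt_trans t2.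
lia.
Qed.

(** With [e = 8 ^ (k - l)], each side of the coarse cell is [[e u, e (u + 1))] in units of level
    [k]; its ends are integers, so no fine cell crosses them. *)
Lemma octadic_cell_nest l k t u y : (l <= k)%N ->
  octadic_cell k t y -> octadic_cell l u y -> octadic_cell k t `<=` octadic_cell l u.
Proof.
move=> lk ty uy z tz i.
have /andP[t1 t2] := ty i; have /andP[u1 u2] := uy i; have /andP[z1 z2] := tz i.
pose e : R := 8 ^+ (k - l).
have ek : 8 ^+ k = e * 8 ^+ l by rewrite -exprD subnK.
rewrite ek -!mulrA in t1 t2 z1 z2.
have e0 : 0 < e by rewrite exprn_gt0.
have eE : e = (8 ^ (k - l))%:R by rewrite /e natrX.
have tu : (8 ^ (k - l) * u i < (t i).+1)%N.
  rewrite -(ltr_nat R) natrM -eE; apply: le_lt_trans t2.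
  by rewrite ler_wpM2l// ltW.
have ut : (t i < 8 ^ (k - l) * (u i).+1)%N.
  rewrite -(ltr_nat R) natrM -eE; apply: le_lt_trans t1 _.
  by rewrite ltr_pM2l.
apply/andP; split.
  rewrite -(ler_pM2l e0); apply: le_trans z1.
  by rewrite eE -natrM ler_nat -ltnS.
rewrite -(ltr_pM2l e0); apply: lt_le_trans z2 _.
by rewrite eE -natrM ler_nat.
Qed.

Lemma octadic_cell_cover l (y : 'rV[R]_d) :
  (forall i, `|y ord0 i| < s / 2) -> exists t, octadic_cell l t y.
Proof.
move=> ys.
have itv i : 0 <= 8 ^+ l * (y ord0 i / s + 2^-1) < (8 ^ l)%:R.
  have /andP[y1 y2] : - 2^-1 < y ord0 i / s < 2^-1.
    by rewrite ltr_pdivlMr// ltr_pdivrMr// mulNr mulrC -ltr_norml.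
  rewrite natrX mulr_ge0 ?exprn_ge0//=; last lra.
  by rewrite -[ltRHS]mulr1 ltr_pM2l ?exprn_gt0//; lra.
have lt8 i : (Num.trunc (8 ^+ l * (y ord0 i / s + 2^-1))%R < 8 ^ l)%N.
  have /andP[y1 y2] := itv i; rewrite -(ltr_nat R); apply: le_lt_trans y2.
  by have /andP[] := truncn_itv y1.
exists [ffun i => Ordinal (lt8 i)] => i; rewrite ffunE/=.
by apply: truncn_itv; case/andP: (itv i).
Qed.

Lemma octadic_cell_small l t y z : octadic_cell l t y -> octadic_cell l t z ->
  forall i, `|y ord0 i - z ord0 i| < s * 8^-1 ^+ l.
Proof.
move=> ty tz i; have /andP[y1 y2] := ty i; have /andP[z1 z2] := tz i.
pose c (x : 'rV[R]_d) := 8 ^+ l * (x ord0 i / s + 2^-1).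
have -> : y ord0 i - z ord0 i = (c y - c z) * (s * 8^-1 ^+ l).
  by rewrite /c exprVn; field; rewrite expf_neq0 ?gt_eqF.
have e0 : 0 < s * 8^-1 ^+ l by rewrite mulr_gt0// exprn_gt0.
rewrite normrM (gtr0_norm e0) -[ltRHS]mul1r ltr_pM2r// ltr_norml /c.
rewrite -[(t i).+1%:R]natr1 in y2 z2; move: y1 y2 z1 z2.
by set a := 8 ^+ l * _; set b := 8 ^+ l * _; lra.
Qed.

(** The cell is an affine copy of the half-open unit cube, whose outer measure is kept as an
    unevaluated constant. *)
Lemma octadic_cell_outer l t : lebesgue_outer (octadic_cell l t) =
  ((s ^+ d * ((8 ^ d)%:R^-1) ^+ l)%:E *
   lebesgue_outer [set x : 'rV[R]_d | forall i, (0 <= x ord0 i < 1)%R])%E.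
Proof.
pose c := s * 8^-1 ^+ l.
have c0 : 0 < c by rewrite mulr_gt0// exprn_gt0.
have -> : s ^+ d * (8 ^ d)%:R^-1 ^+ l = c ^+ d.
  by rewrite exprMn natrX -exprVn exprAC.
pose v : 'rV[R]_d := \row_i (s * ((t i)%:R * 8^-1 ^+ l - 2^-1)).
rewrite -(lebesgue_outer_affine c v)//; congr lebesgue_outer.
have c8 : c * 8 ^+ l = s.
  by rewrite /c -mulrA -exprMn mulVf ?expr1n ?mulr1.
apply/seteqP; split=> [y ty|_ [x x01 <-] i].
  exists (c^-1 *: (y - v)); last by rewrite scalerA divff ?gt_eqF// scale1r subrK.
  move=> i; have /andP[y1 y2] := ty i; rewrite !mxE.
  have -> : c^-1 * (y ord0 i - s * ((t i)%:R * 8^-1 ^+ l - 2^-1)) =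
      8 ^+ l * (y ord0 i / s + 2^-1) - (t i)%:R.
    rewrite /c exprVn; field; rewrite expf_neq0 ?gt_eqF//.
  by rewrite -[(t i).+1%:R]natr1 in y2; move: y1 y2; set a := 8 ^+ l * _; lra.
have /andP[x0 x1] := x01 i; rewrite !mxE.
have -> : 8 ^+ l * ((c * x ord0 i + s * ((t i)%:R * 8^-1 ^+ l - 2^-1)) / s + 2^-1) =
    (t i)%:R + x ord0 i.
  by rewrite /c exprVn; field; rewrite expf_neq0 ?gt_eqF.
by rewrite -[(t i).+1%:R]natr1; lra.
Qed.

Local Notation borel := (g_sigma_algebraType [set O : set 'rV[R]_d | open O]).

Lemma measurable_coord_lt (i : 'I_d) (b : R) :
  measurable ([set y | y ord0 i < b] : set borel).
Proof.
apply: sub_sigma_algebra => /=.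
have := @open_comp _ _ (fun y : 'rV[R]_d => y ord0 i) [set x | x < b].
apply; last exact: open_lt.
by move=> y _; exact: coord_continuous.
Qed.

Lemma measurable_octadic_cell l t : measurable (octadic_cell l t : set borel).
Proof.
pose e b := (b / 8 ^+ l - 2^-1) * s.
have eE (y b : R) : (8 ^+ l * (y / s + 2^-1) < b) = (y < e b).
  by rewrite mulrC -ltr_pdivlMr ?exprn_gt0// -ltrBrDr ltr_pdivrMr.
have -> : octadic_cell l t = \bigcap_(i in [set: 'I_d])
    (~` [set y | y ord0 i < e (t i)%:R] `&` [set y | y ord0 i < e (t i).+1%:R]).
  apply/seteqP; split=> y ty i; first move=> _.
    have /andP[y1 y2] := ty i; split=> /=; rewrite -eE //.
    by apply/negP; rewrite -leNgt.
  have [/= /negP] := ty i I; rewrite -!eE -leNgt => -> ->//.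
apply: fin_bigcap_measurable => // i _.
by apply: measurableI; [apply: measurableC|]; exact: measurable_coord_lt.
Qed.

End octadic_cells.

(** * Uniform laws *)

(** Applied to one of the points, this gives a measure that equals the quotient of outer measures,
    which is thereby countably additive on Borel sets. *)
Lemma law_exists {R : realType} {dT : measure_display} {T : measurableType dT}
  {V : pointedType} (G : set (set V)) (P : probability T R) (X : T -> V) :
  (forall B, (<<s G >>) B -> measurable (X @^-1` B)) ->
  exists mu : probability (g_sigma_algebraType G) R,
    forall B, mu B = P (X @^-1` B).
Proof.
move=> mX; pose Y : T -> g_sigma_algebraType G := X.
have mY : measurable_fun setT Y by move=> _ B mB; rewrite setTI; exact: mX.
pose f : {mfun T >-> g_sigma_algebraType G} :=
  HB.pack Y (isMeasurableFun.Build _ _ _ _ Y mY).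
by exists (distribution P f).
Qed.

(** Expansion in the standard basis bounds [N x] by [S * e]; the extra 1 in the constant makes it
    positive and the inequality strict. *)
Lemma is_norm_le_coord {R : realType} {d : nat} (N : 'rV[R]_d -> R) :
  (0 < d)%N -> is_norm N ->
  exists2 C : R, 0 < C & forall (x : 'rV[R]_d) (e : R),
    (forall i, `|x ord0 i| < e) -> N x < C * e.
Proof.
move=> d0 [_ ND NZ].
have N0 : N 0 = 0 by rewrite -(scale0r (0 : 'rV[R]_d)) NZ normr0 mul0r.
have N_ge0 x : 0 <= N x.
  have : N (x - x) <= N x + N (- x) by exact: ND.
  by rewrite subrr N0 -scaleN1r NZ normrN1 mul1r; lra.
pose S := \sum_(i < d) N (delta_mx 0 i).
exists (1 + S); first by rewrite ltr_pwDl// sumr_ge0.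
move=> x e xe; have e0 : 0 < e by apply: le_lt_trans (xe (Ordinal d0)).
rewrite mulrDl mul1r ltr_pwDl// {1}(row_sum_delta x).
apply: (@le_trans _ _ (\sum_(i < d) `|x 0 i| * N (delta_mx 0 i))).
  elim/big_ind2 : _ => [|a b a' b' ab a'b'|i _]; first by rewrite N0.
  - by apply: le_trans (ND _ _) _; exact: lerD.
  - by rewrite NZ.
rewrite mulr_suml; apply: ler_sum => i _.
by rewrite mulrC ler_wpM2l// ltW// xe.
Qed.

Lemma bounded_coord {R : realType} {d : nat} (U : set 'rV[R]_d) :
  bounded_set U -> exists2 s : R, 0 < s &
    forall y, U y -> forall i, `|y ord0 i| < s / 2.
Proof.
move=> [M [_ bM]]; pose e := Num.max M 0 + 1.
have e0 : 0 < e by rewrite ltr_wpDl// le_max lexx orbT.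
have Me : M < e by rewrite ltr_pwDr// le_max lexx.
exists ((e + 1) * 2); first by rewrite mulr_gt0// addr_gt0.
move=> y Uy i; rewrite mulfK//; apply: (@le_lt_trans _ _ e); last by rewrite ltrDl.
apply: le_trans (bM e Me y Uy).
have -> : `|y| = mx_norm y by [].
by rewrite mx_normrE; exact: (le_bigmax _ (fun ij => `|y ij.1 ij.2|) (ord0, i)).
Qed.

Lemma coord_ball {R : realType} {d : nat} (x y : 'rV[R]_d) (e : R) : 0 < e ->
  (forall i, `|x ord0 i - y ord0 i| < e) -> ball x e y.
Proof. by move=> e0 xy; split=> // i j; rewrite ord1; exact: xy. Qed.

Lemma closed_eventually_off {R : realType} {d : nat} (x : nat -> 'rV[R]_d)
  (r : nat -> R) (m : nat) :
  closed [set y | forall n, (m <= n)%N -> ~ ball (x n) (r n) y].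
Proof.
have -> : [set y | forall n, (m <= n)%N -> ~ ball (x n) (r n) y] =
    \bigcap_(n in [set n | (m <= n)%N]) ~` ball (x n) (r n) by [].
by apply: closed_bigI => n _; apply: open_closedC; exact: ball_open.
Qed.

Section uniform_law.
Context {R : realType} {d : nat} (U : set 'rV[R]_d).
Local Notation borel := (g_sigma_algebraType [set O : set 'rV[R]_d | open O]).
Variable mu : probability borel R.
Hypothesis oU : open U.
Hypothesis muE : forall B : set borel, measurable B ->
  mu B = (fine (lebesgue_outer (B `&` U)) / fine (lebesgue_outer U))%:E.
Variable s : R.
Hypothesis s0 : 0 < s.
Hypothesis Us : forall y, U y -> forall i, `|y ord0 i| < s / 2.

Local Notation T := (fun l => {ffun 'I_d -> 'I_(8 ^ l)}).
Local Notation Q := (@octadic_cell R d s).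
Local Notation q := ((8 ^ d)%:R^-1 : R).

(** The volume of the level-0 cube relative to that of [U]. *)
Definition unit_cell_mass : R :=
  s ^+ d * fine (lebesgue_outer [set x : 'rV[R]_d | forall i, 0 <= x ord0 i < 1])
  / fine (lebesgue_outer U).
Local Notation p0 := unit_cell_mass.

Lemma measurable_open (O : set 'rV[R]_d) : open O -> measurable (O : set borel).
Proof. by move=> oO; exact: sub_sigma_algebra. Qed.

Lemma measurable_closed (F : set 'rV[R]_d) : closed F -> measurable (F : set borel).
Proof.
by move=> cF; rewrite -[F]setCK; apply: measurableC; apply: measurable_open;
  exact: closed_openC.
Qed.

(** Otherwise division by 0, which yields 0, would give the law total mass 0. *)
Lemma fine_outer_neq0 : fine (lebesgue_outer U) != 0.
Proof.
apply/eqP => U0; have := probability_setT mu.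
by rewrite muE// U0 invr0 mulr0 => /eqP; rewrite eqe eq_sym oner_eq0.
Qed.

Lemma law_domain : mu U = 1%E.
Proof. by rewrite muE ?setIid ?divff ?fine_outer_neq0//; exact: measurable_open. Qed.

(** [fine] also sends infinite values to 0; monotonicity and the finite outer measure of [U] rule
    these out. *)
Lemma outer_null_of_law (B : set borel) : measurable B -> mu B = 0%E ->
  lebesgue_outer (B `&` U) = 0%E.
Proof.
move=> mB; rewrite muE// => /eqP; rewrite eqe mulf_eq0 invr_eq0.
rewrite (negbTE fine_outer_neq0) orbF => /eqP BU0.
have : (lebesgue_outer (B `&` U) <= lebesgue_outer U)%E.
  by apply: le_lebesgue_outer => y [].
move: (lebesgue_outer_ge0 (B `&` U)) fine_outer_neq0 BU0.
by case: (lebesgue_outer (B `&` U)) (lebesgue_outer U) => [x||] [y||]//=;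
  rewrite ?eqxx// => _ _ ->.
Qed.

Lemma octadic_mass l t : Q l t `<=` U -> fine (mu (Q l t)) = p0 * q ^+ l.
Proof.
move=> QU; rewrite muE; last exact: measurable_octadic_cell.
rewrite (_ : Q l t `&` U = Q l t); last exact/setIidl.
rewrite /= octadic_cell_outer// /unit_cell_mass.
have c0 : 0 < s ^+ d * q ^+ l.
  by rewrite mulr_gt0 ?exprn_gt0// invr_gt0 ltr0n expn_gt0.
(* Both sides are 0 when [L] is infinite. *)
set L := lebesgue_outer _; have -> : fine ((s ^+ d * q ^+ l)%:E * L) =
    s ^+ d * q ^+ l * fine L.
  case: L => [x//||]; first by rewrite gt0_muley ?lte_fin// mulr0.
  by rewrite gt0_muleNy ?lte_fin// mulr0.
by ring.
Qed.

Lemma point_cell_in_open (O : set 'rV[R]_d) (y : 'rV[R]_d) : open O -> O y ->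
  exists k0, forall k, (k0 <= k)%N -> @point_cell _ borel T Q k y `<=` O.
Proof.
move=> oO Oy; have /nbhs_ballP[e /= e0 eO] := open_nbhs_nbhs (conj oO Oy).
pose k0 := Num.trunc (s / e); exists k0.+1 => k k0k z [t ty tz].
apply: eO; apply: coord_ball => // i.
apply: lt_trans (octadic_cell_small _ s0 _ _ _ _ ty tz i) _.
rewrite exprVn ltr_pdivrMr ?exprn_gt0// mulrC -ltr_pdivrMr//.
have /truncn_itv/andP[_ sb] : 0 <= s / e by rewrite divr_ge0// ltW.
apply: lt_le_trans sb _; rewrite -natrX ler_nat.
by apply: leq_trans k0k _; apply: ltnW; exact: ltn_expl.
Qed.

Lemma octadic_cover l y : U y -> exists t, Q l t y.
Proof. by move=> Uy; apply: octadic_cell_cover => //; exact: Us. Qed.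

Lemma octadic_thin_null (F : set 'rV[R]_d) (c : R) : closed F -> 0 <= c < 1 ->
  (forall k t, Q k t `<=` U ->
    fine (mu (F `&` Q k t)) <= c * fine (mu (Q k t))) ->
  mu (F `&` U) = 0%E.
Proof.
move=> cF c01 thin.
apply: (@thin_set_null R _ borel mu T Q U _ _ octadic_cover F c) => //.
- by move=> l t u y; exact: octadic_cell_disj.
- by move=> l t; exact: measurable_octadic_cell.
- exact: measurable_closed.
- exact: measurable_open.
- by move=> y Uy; exact: point_cell_in_open.
- move=> y _ nFy; apply: point_cell_in_open => //; exact: closed_openC.
Qed.

(** If [p0] were 0, all cells inside [U] would be null, and the density argument with [F = setT] and
    [c = 0] would make [U] null. *)
Lemma unit_cell_mass_gt0 : 0 < p0.
Proof.
have p0_ge0 : 0 <= p0.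
  by rewrite !mulr_ge0 ?exprn_ge0 ?invr_ge0 ?fine_ge0 ?lebesgue_outer_ge0// ltW.
rewrite lt_neqAle p0_ge0 andbT; apply/eqP => p00.
have := law_domain; rewrite -[U]setTI (octadic_thin_null setT 0)//.
- by move=> /eqP; rewrite eqe eq_sym oner_eq0.
- by rewrite lexx ltr01.
- by move=> k t QU; rewrite setTI octadic_mass// -p00 !mul0r.
Qed.

End uniform_law.

Lemma independent_rvs_block {R : realType} {dT : measure_display}
  {T : measurableType dT} (P : probability T R) (d : nat)
  (X : nat -> T -> 'rV[R]_d) (B : set 'rV[R]_d) (x : R) (a n : nat) :
  independent_rvs P X -> borel_Rd B -> (forall i, P (X i @^-1` B) = x%:E) ->
  P (\bigcap_(i in [set i | (a <= i < a + n)%N]) X i @^-1` B) = (x ^+ n)%:E.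
Proof.
move=> indep BB PX.
have -> : [set i | (a <= i < a + n)%N] = [set i | i \in iota a n].
  by apply/seteqP; split=> i /=; rewrite mem_iota.
rewrite (indep _ (fun=> B)) ?iota_uniq//.
under eq_bigr => i _ do rewrite PX.
by rewrite prodEFin big_const_seq count_predT size_iota iter_mulr_1.
Qed.

Theorem theorem13p1 (R : realType) (d : nat) (N : 'rV[R]_d -> R)
    (U : set 'rV[R]_d)
    (dT : measure_display) (T : measurableType dT) (P : probability T R)
    (X : nat -> T -> 'rV[R]_d) :
  (0 < d)%N ->
  is_norm N ->
  open U -> bounded_set U -> U !=set0 ->
  (forall n B, borel_Rd B -> measurable (X n @^-1` B)) ->
  (forall n B, borel_Rd B ->
     P (X n @^-1` B) =
     (fine (lebesgue_outer (B `&` U)) / fine (lebesgue_outer U))%:E) ->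
  independent_rvs P X ->
  {ae P, forall w, uniformly_eutaxic N U (fun n => X n w)}.
Proof.
move=> d0 normN oU bU _ mX lawX indep.
have [mu mu_law] := law_exists [set O : set 'rV[R]_d | open O] P (X 0%N) (mX 0%N).
have muE B : borel_Rd B ->
    mu B = (fine (lebesgue_outer (B `&` U)) / fine (lebesgue_outer U))%:E.
  by move=> BB; rewrite mu_law lawX.
have [s s0 Us] := bounded_coord U bU.
have [C C0 NC] := is_norm_le_coord N d0 normN.
pose borel := g_sigma_algebraType [set O : set 'rV[R]_d | open O].
pose Idx l : finType := {ffun 'I_d -> 'I_(8 ^ l)}.
pose Q : forall l, Idx l -> set borel := fun l t => octadic_cell s l t.
pose p0 := @unit_cell_mass R d U s.
pose q : R := (8 ^ d)%:R^-1.
have p0_gt0 : 0 < p0 by exact: (unit_cell_mass_gt0 U mu oU muE s s0 Us).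
have p0_ge0 := ltW p0_gt0.
have Qdisj l t u y : Q l t y -> Q l u y -> t = u by exact: octadic_cell_disj.
have Qnest l k t u y : (l <= k)%N -> Q k t y -> Q l u y -> Q k t `<=` Q l u.
  exact: octadic_cell_nest.
have mQ l t : measurable (Q l t) by exact: measurable_octadic_cell.
have Qcover l y : U y -> exists t, Q l t y by move=> /Us; exact: octadic_cell_cover.
have Qmass l t : Q l t `<=` U -> fine (mu (Q l t)) = p0 * q ^+ l.
  exact: (octadic_mass U mu muE s s0).
have q_itv : 0 < q <= 8^-1.
  rewrite invr_gt0 ltr0n expn_gt0/= lef_pV2 ?posrE ?ltr0n ?expn_gt0//.
  by rewrite ler_nat -[in leqLHS](expn1 8) leq_exp2l.
pose M := (Num.trunc (4 / p0)).+1.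
have M_large : 4 <= M%:R * p0.
  rewrite -ler_pdivrMr// ltW//.
  by have /truncn_itv/andP[] : 0 <= 4 / p0 by rewrite divr_ge0.
(* This event is fixed before any radii are chosen and handles the countably many cells at once, so
   it serves every [r]. *)
have many : {ae P, forall w, forall g (u : Idx g), Q g u `<=` U ->
    exists j0, forall j, (j0 <= j)%N ->
    p0 * q ^+ g / 2 <= #|@hits _ borel Idx Q M (8 ^ d) g u (fun n => X n w) j|%:R *
                       (p0 * q ^+ j)}.
  apply: ae_foralln => g; apply: filter_forall => u.
  have [uU|nuU] := pselect (Q g u `<=` U); last by apply: nearW => w /nuU.
  apply: filterS (ae_many_hits mu Idx Q U p0 q Qdisj Qnest mQ Qcover Qmass
    p0_ge0 q_itv M (8 ^ d) g u uU erefl p0_gt0 P X mX _ M_large) => [w + _//|].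
  move=> B a n mB; apply: independent_rvs_block => // i.
  by rewrite lawX// muE.
apply: filterS many => w many r rP.
(* With the scale [s * C], a cell of side [s / 8 ^ k j] around [X n w] fits in its sup-norm ball of
   radius [r n / C], for [n] in block [j]. *)
have [k [k_ge k_small k_div]] :=
  radii_seq_condense d r d0 rP M (s * C) isT (mulr_gt0 s0 C0).
have rC n : 0 < r n / C by rewrite divr_gt0// (radii_seq_gt0 d).
(* Sup-norm balls of radius [r n / C] lie in the [N]-balls of radius [r n]; being open, they make
   [F m] closed. *)
pose F m : set 'rV[R]_d :=
  [set y | forall n, (m <= n)%N -> ~ ball (X n w) (r n / C) y].
have mF m : measurable (F m : set borel).
  by apply: measurable_closed; exact: closed_eventually_off.
have F_null m : mu (F m `&` U) = 0%E.
  apply: (octadic_thin_null U mu oU s s0 Us (F m) (7 / 8)).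
  - exact: closed_eventually_off.
  - by lra.
  move=> g u uU; have [j0 hits_large] := many g u uU.
  apply: (hits_thin mu Idx Q U p0 q Qdisj Qnest mQ Qcover Qmass p0_ge0 q_itv
    M (8 ^ d) g u uU p0_gt0 (fun n => X n w) k (F m) (maxn j0 m)) => //.
    by move=> j; rewrite geq_max => /andP[/hits_large].
  move=> j n; rewrite geq_max => /andP[_ mj] /andP[jn nj] y [t tx ty] Fy.
  (* Here [n >= M D ^ j >= D ^ j > j >= m]. *)
  apply: (Fy n).
    apply: leq_trans jn; apply: leq_trans mj _.
    apply: leq_trans (leq_pmull _ (isT : 0 < M)%N).
    by apply: ltnW; apply: ltn_expl; rewrite -(expn0 8) ltn_exp2l.
  apply: coord_ball => // i.
  apply: lt_le_trans (octadic_cell_small _ s0 _ _ _ _ tx ty i) _.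
  rewrite ler_pdivlMr// mulrAC; apply: le_trans (k_small j) _.
  by apply: (radii_seq_le d r rP); exact: ltnW.
pose bad : set borel := \bigcup_m (F m `&` U).
have mFU m : measurable (F m `&` U : set borel).
  by apply: measurableI => //; exact: measurable_open.
have mbad : measurable bad by exact: bigcup_measurable.
have bad_null : mu bad = 0%E.
  apply/(negligibleP _ mbad); apply: negligible_bigcup => m.
  by apply/(negligibleP _ (mFU m)); exact: F_null.
have := outer_null_of_law U mu muE bad mbad bad_null.
set B := _ `&` U => B0; apply/eqP; rewrite eq_le lebesgue_outer_ge0 andbT -B0.
apply: le_lebesgue_outer => y [Uy /finite_fsetP[S SE]]; split=> //.
(* A point hit finitely often lies in [F b.+1], with [b] the largest index that hits it. *)
pose b := \max_(n <- finmap.enum_fset S) n.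
exists b.+1 => //; split=> // n bn [_ xy].
have nS : n \in finmap.enum_fset S.
  suff : [set i | N (y - X i w) < r i] n by rewrite SE.
  apply: lt_le_trans (NC _ (r n / C) _) _.
    by move=> i; rewrite !mxE distrC; exact: xy.
  by rewrite mulrC divfK// gt_eqF.
by have := leq_bigmax_seq (F := id) n nS isT; rewrite leqNgt bn.
Qed.
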